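(* Let $p>2$ be a prime, $r\ge 1$, $\mathbf{k}=\mathbf{F}_p(x_{1j},x_{2j}\mid j=1,\ldots,r)$ the rational function field in $2r$ indeterminates, and let $G=(\mathbf{Z}/p)^r=\langle e_1,\ldots,e_r\rangle$ act on $\mathbf{k}[x,y,z]$ by $\mathbf{k}$-algebra automorphisms with $x\cdot e_j=x$, $y\cdot e_j=y+x_{1j}x$, $z\cdot e_j=z+2x_{1j}y+(x_{1j}^2+x_{2j})x$. Let $f_1,f_2\in\mathbf{k}[x,y,z]^G$ be the invariants defined in the context. Then $$\mathbf{k}[x,y,z]^G[x^{-1}]=\mathbf{k}[x,f_1,f_2][x^{-1}].$$
   Context: Let $\delta=y^2-xz$. Let $\Gamma$ be the $2(r+1)\times r$ matrix whose row $2i+1$ is $(x_{11}^{p^i},\ldots,x_{1r}^{p^i})$ and whose row $2i+2$ is $(x_{21}^{p^i},\ldots,x_{2r}^{p^i})$, for $i=0,1,\ldots,r$. For a subsequence $I=(i_1,\ldots,i_r)$ of $(1,2,\ldots,2r+2)$, $\gamma_I\in\mathbf{k}$ is the $r\times r$ minor of $\Gamma$ on the rows $I$. Let $\widetilde\Gamma$ be the $2(r+1)\times(r+1)$ matrix obtained from $\Gamma$ by appending as last column $[y/x,\,-\delta/x^2,\,(y/x)^p,\,(-\delta/x^2)^p,\ldots,(y/x)^{p^r},\,(-\delta/x^2)^{p^r}]^T$. For a subsequence $J=(j_1,\ldots,j_{r+1})$ of $(1,\ldots,2r+2)$, let $\tilde f_J\in\mathbf{k}[x,y,z][x^{-1}]$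 be the $(r+1)\times(r+1)$ minor of $\widetilde\Gamma$ on the rows $J$, and let $f_J\in\mathbf{k}[x,y,z]$ be obtained by minimally clearing the denominator of $\tilde f_J$, i.e. multiplying by the smallest power of $x$ that gives a polynomial; $f_J$ is $G$-invariant. Put $s=\lceil r/2\rceil$ and $f_1=f_{(1,2,\ldots,r+1)}$. If $r$ is odd, put $f_2=f_{(1,2,\ldots,r,r+2)}$. If $r$ is even, put $$f_2=\frac{\gamma_{(1,2,\ldots,r)}f_{(1,2,\ldots,r,r+2)}+f_1^2}{2x^{p^s-2p^{s-1}}},$$ which is a polynomial. *)

(* Defs.v *)
From HB Require Import structures.
From mathcomp Require Import all_boot all_order all_algebra all_fingroup.
From mathcomp Require Import boolp classical_sets.
From mathcomp Require Import mpoly.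
From mathcomp Require Import ring.

Set Implicit Arguments.
Unset Strict Implicit.
Unset Printing Implicit Defensive.

Import GRing.Theory.
Local Open Scope classical_set_scope.
Local Open Scope ring_scope.

Notation coefRing p r := {mpoly 'F_p[(r + r)%N]}.
Notation coefField p r := {fraction (coefRing p r)}.
Notation polRing p r := {mpoly (coefField p r)[3]}.
(* [coefField p r](x, y, z), in which k[x,y,z][1/x] is a subring *)
Notation ratField p r := {fraction (polRing p r)}.

(* The indeterminates x_{1j} and x_{2j} are the first and the last r variables
   of [coefRing p r]. *)
Definition coefX1 (p r : nat) (j : 'I_r) : coefField p r :=
  tofrac ('X_(lshift r j) : coefRing p r).

Definition coefX2 (p r : nat) (j : 'I_r) : coefField p r :=
  tofrac ('X_(rshift r j) : coefRing p r).

Definition varx (p r : nat) : polRing p r := 'X_(inord 0).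
Definition vary (p r : nat) : polRing p r := 'X_(inord 1).
Definition varz (p r : nat) : polRing p r := 'X_(inord 2).

Definition delta (p r : nat) : polRing p r :=
  vary p r ^+ 2 - varx p r * varz p r.

(* (Z/p)^r is the additive group 'rV['F_p]_r, with e_j the j-th unit vector.
   MathComp actions are right actions: [to f (g * h) = to (to f g) h]; being
   part of an action, each [to^~ g] is bijective. *)
Definition is_G_action (p r : nat)
    (to : {action 'rV['F_p]_r &-> polRing p r}) : Prop :=
  (forall g, linear (to^~ g) /\ monoid_morphism (to^~ g)) /\
  forall j : 'I_r,
    [/\ to (varx p r) (delta_mx 0 j) = varx p r,
        to (vary p r) (delta_mx 0 j)
          = vary p r + coefX1 p j *: varx p r &
        to (varz p r) (delta_mx 0 j)
          = varz p r + (2 * coefX1 p j) *: vary p r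
            + (coefX1 p j ^+ 2 + coefX2 p j) *: varx p r].

Definition invariants (p r : nat)
    (to : {action 'rV['F_p]_r &-> polRing p r}) : set (polRing p r) :=
  [set f | forall g, to f g = f].

(* Rows are numbered from 0: for i = 2m (resp. 2m + 1), row i holds
   the p^m-th powers of the x_{1j} (resp. of the x_{2j}). *)
Definition Gamma (p r : nat) : 'M[coefField p r]_(r.*2.+2, r) :=
  \matrix_(i, j) (if odd i then coefX2 p j else coefX1 p j) ^+ (p ^ i./2).

Definition gamma (p r : nat) (I : 'I_r -> 'I_(r.*2.+2)) : coefField p r :=
  \det (rowsub I (Gamma p r)).

Definition GammaCol (p r : nat) : 'cV[ratField p r]_(r.*2.+2) :=
  \col_i (if odd i then - tofrac (delta p r) / tofrac (varx p r) ^+ 2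
          else tofrac (vary p r) / tofrac (varx p r)) ^+ (p ^ i./2).

Definition GammaTilde (p r : nat) : 'M[ratField p r]_(r.*2.+2, r + 1) :=
  row_mx (map_mx (fun c : coefField p r => tofrac (c%:MP : polRing p r))
                 (Gamma p r))
         (GammaCol p r).

Definition fTilde (p r : nat) (J : 'I_(r + 1) -> 'I_(r.*2.+2)) : ratField p r :=
  \det (rowsub J (GammaTilde p r)).

Definition clears (p r : nat) (a : ratField p r) (n : nat) (f : polRing p r) :=
  tofrac f = tofrac (varx p r) ^+ n * a.

(* The polynomial x^n a with n : nat least such that x^n a is a polynomial
   (it is unique; 0 is a dummy value for a outside k[x,y,z][1/x]). *)
Definition clear_denominator (p r : nat) (a : ratField p r) : polRing p r :=
  xget 0 [set f | exists2 n, clears a n f &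
                  forall m g, clears a m g -> (n <= m)%N].

Definition fJ (p r : nat) (J : 'I_(r + 1) -> 'I_(r.*2.+2)) : polRing p r :=
  clear_denominator (fTilde p J).

(* The row sequences (1,...,r), (1,...,r+1) and (1,...,r,r+2), 0-based. *)
Definition rows_I (r : nat) (i : 'I_r) : 'I_(r.*2.+2) := inord i.
Definition rows_J1 (r : nat) (i : 'I_(r + 1)) : 'I_(r.*2.+2) := inord i.
Definition rows_J2 (r : nat) (i : 'I_(r + 1)) : 'I_(r.*2.+2) :=
  inord (if (i < r)%N then i : nat else r.+1).

Definition f1 (p r : nat) : polRing p r := fJ p (@rows_J1 r).

(* For r even, f2 is the polynomial equal to the fraction below (0 is a dummy
   value, taken only if that fraction were not a polynomial); [uphalf r] is the
   ceiling of r/2. *)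
Definition f2 (p r : nat) : polRing p r :=
  if odd r then fJ p (@rows_J2 r)
  else
    let s := uphalf r in
    xget 0 [set f | tofrac f =
      tofrac (gamma p (@rows_I r) *: fJ p (@rows_J2 r) + f1 p r ^+ 2)
      / (2 * tofrac (varx p r) ^+ (p ^ s - 2 * p ^ s.-1))].

(* the k-subalgebra k[x, g, h] of k[x,y,z] *)
Definition alg_gen (p r : nat) (g h : polRing p r) : set (polRing p r) :=
  [set Q \mPo [tuple varx p r; g; h] | Q in [set: polRing p r]].

(* For S a subring of k[x,y,z] containing x, the subring S[1/x] of
   [ratField p r]. *)
Definition localize_x (p r : nat) (S : set (polRing p r)) : set (ratField p r) :=
  [set a | exists s, exists2 n, S s & a = tofrac s / tofrac (varx p r) ^+ n].

(* An action as in [is_G_action] exists. *)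
Section ActionExists.
Variables p r : nat.

Let a (g : 'rV['F_p]_r) : coefField p r :=
  tofrac (\sum_j (g 0 j)%:MP * 'X_(lshift r j) : coefRing p r).
Let b (g : 'rV['F_p]_r) : coefField p r :=
  tofrac (\sum_j (g 0 j)%:MP * 'X_(rshift r j) : coefRing p r).

Let subst (g : 'rV['F_p]_r) : 3.-tuple (polRing p r) :=
  [tuple varx p r; vary p r + a g *: varx p r;
         varz p r + (2 * a g) *: vary p r + (a g ^+ 2 + b g) *: varx p r].

Let toX (f : polRing p r) g := f \mPo (subst g).

Let toXx g : toX (varx p r) g = varx p r.
Proof. by rewrite /toX /varx comp_mpolyXU inordK. Qed.

Let toXy g : toX (vary p r) g = vary p r + a g *: varx p r.
Proof. by rewrite /toX {1}/vary comp_mpolyXU inordK. Qed.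

Let toXz g : toX (varz p r) g =
  varz p r + (2 * a g) *: vary p r + (a g ^+ 2 + b g) *: varx p r.
Proof. by rewrite /toX {1}/varz comp_mpolyXU inordK. Qed.

Let aD g h : a (g + h) = a g + a h.
Proof.
rewrite /a -rmorphD -big_split; congr (tofrac _); apply: eq_bigr => j _ /=.
by rewrite mxE mpolyCD mulrDl.
Qed.

Let bD g h : b (g + h) = b g + b h.
Proof.
rewrite /b -rmorphD -big_split; congr (tofrac _); apply: eq_bigr => j _ /=.
by rewrite mxE mpolyCD mulrDl.
Qed.

Let a_delta j : a (delta_mx 0 j) = coefX1 p j.
Proof.
rewrite /a (bigD1 j) //= big1 => [|i /negPf ne_ij]; rewrite mxE !eqxx /=.
  by rewrite addr0 mpolyC1 mul1r.
by rewrite ne_ij mpolyC0 mul0r.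
Qed.

Let b_delta j : b (delta_mx 0 j) = coefX2 p j.
Proof.
rewrite /b (bigD1 j) //= big1 => [|i /negPf ne_ij]; rewrite mxE !eqxx /=.
  by rewrite addr0 mpolyC1 mul1r.
by rewrite ne_ij mpolyC0 mul0r.
Qed.

Let a0 : a 0 = 0.
Proof. by apply: (addrI (a 0)); rewrite -aD !addr0. Qed.

Let b0 : b 0 = 0.
Proof. by apply: (addrI (b 0)); rewrite -bD !addr0. Qed.

Let alg_ext (u v : {lrmorphism polRing p r -> polRing p r}) :
    u (varx p r) = v (varx p r) -> u (vary p r) = v (vary p r) ->
    u (varz p r) = v (varz p r) -> u =1 v.
Proof.
move=> ex ey ez f; rewrite (mpolyE f) !linear_sum; apply: eq_bigr => m _.
rewrite !linearZ; congr (_ *: _); rewrite mpolyXE_id !rmorph_prod.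
apply: eq_bigr => i _; rewrite !rmorphXn; congr (_ ^+ _).
have -> : i = inord i by rewrite inord_val.
by case: i => [[|[|[|]]]] //=.
Qed.

Let toX0 f : toX f 1%g = f.
Proof.
have toXid : comp_mpoly (subst 1%g) =1 idfun.
  apply: alg_ext => /=; [exact: toXx | rewrite [LHS]toXy | rewrite [LHS]toXz].
    by rewrite a0 scale0r addr0.
  by rewrite a0 b0 expr0n mulr0 !addr0 !scale0r !addr0.
exact: toXid.
Qed.

Let toXM f g h : toX f (g * h)%g = toX (toX f g) h.
Proof.
have toXcomp : comp_mpoly (subst (g + h)) =1
               (comp_mpoly (subst h) \o comp_mpoly (subst g)).
  have toXD u v w : toX (u + v) w = toX u w + toX v w.
    exact: (raddfD (comp_mpoly (subst w))).
  have toXZ c u w : toX (c *: u) w = c *: toX u w.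
    exact: comp_mpolyZ.
  apply: alg_ext => /=.
  - by rewrite -!/(toX _ _) !toXx.
  - by rewrite -!/(toX _ _) !(toXD, toXZ, toXx, toXy) aD scalerDl -addrA
      [a h *: _ + _]addrC.
  - rewrite -!/(toX _ _) !(toXD, toXZ, toXx, toXy, toXz) aD bD.
    rewrite -!mul_mpolyC !(mpolyCD, mpolyCM, rmorphXn) /=.
    by ring.
exact: toXcomp.
Qed.

Lemma is_G_action_exists :
  exists to : {action 'rV['F_p]_r &-> polRing p r}, is_G_action to.
Proof.
exists (TotalAction toX0 toXM); split=> [g | j].
  split; first exact: (linearP (comp_mpoly (subst g))).
  by split; [exact: rmorph1 (comp_mpoly (subst g))
           | exact: rmorphM (comp_mpoly (subst g))].
by rewrite /= toXx toXy toXz a_delta b_delta.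
Qed.

End ActionExists.

(* Main.v *)
Require Import Defs.
From HB Require Import structures.
From mathcomp Require Import all_boot all_order all_algebra all_fingroup all_field.
From mathcomp Require Import boolp classical_sets.
From mathcomp Require Import mpoly.
From mathcomp Require Import zify ring.

(* With T = y/x and U = -delta/x^2 one has k[x,y,z][1/x] = k[x,1/x][T,U], and G
   acts by translating (T,U) by vectors of an F_p-subspace V of k^2 of rank r.
   The determinants F_J = fTilde J are linear in the entries T^(p^m), U^(p^m) of
   the last column, hence are additive polynomials vanishing on V, hence are
   G-invariant.  Giving T weight 1 and U weight 2, the weights of the rows are
   strictly increasing, so the leading terms of the two determinants are
   gamma T^P and gamma U^Q with P Q = p^r = #|G|, where gamma <> 0 because the
   terms of its Leibniz expansion are distinct monomials.  Division by the two
   determinants writes any f as sum b_ij T^i U^j with i < P, j < Q and b_ij in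
   B = k[x,1/x][F_1,F_2], and the same b_ij serve for all translates of f.  By
   Lagrange interpolation (the translates of T are distinct) and division, the
   P Q functions T^i U^j span all functions on G, so they are linearly
   independent; thus for an invariant f only b_00 survives, and f = b_00 is
   in B.
   For r even, modulo the power of x dividing in the definition of f_2 one has
   f_1 = gamma y^(p^s) and f_(1,...,r,r+2) = - gamma y^(2p^s), so f_2 is a
   polynomial, and F_2 is recovered from f_1 and f_2 since 2, gamma and x are
   units. *)

Set Implicit Arguments.
Unset Strict Implicit.
Unset Printing Implicit Defensive.

Import GRing.Theory.
Local Open Scope ring_scope.

(** * Functions on a finite set reduced modulo two relations *)

Definition subsemiring (L : pzSemiRingType) (S : set L) : Prop :=
  [/\ S 0, S 1, (forall a b, S a -> S b -> S (a + b)) &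
      forall a b, S a -> S b -> S (a * b)].

Lemma subsemiring_setT (L : pzSemiRingType) : subsemiring [set: L].
Proof. by []. Qed.

Section ReducedSpan.
Variables (L : fieldType) (G : finType) (T U : G -> L) (P Q : nat).

(** The coefficients are fixed before [g]: one expansion has to serve every translate at once. *)
Definition mspan (S : set L) (phi : G -> L) : Prop :=
  exists2 c : 'I_P * 'I_Q -> L, (forall e, S (c e)) &
    forall g, phi g = \sum_e c e * (T g ^+ e.1 * U g ^+ e.2).

Section Closure.
Variable S : set L.
Hypothesis S_semiring : subsemiring S.

Lemma mspan_ext phi psi : phi =1 psi -> mspan S phi -> mspan S psi.
Proof. by move=> eq_f [c Sc cE]; exists c => // g; rewrite -eq_f. Qed.

Lemma mspan0 : mspan S (fun=> 0).
Proof.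
have [S0 _ _ _] := S_semiring.
by exists (fun=> 0) => // g; rewrite big1 // => e _; rewrite mul0r.
Qed.

Lemma mspanD phi psi :
  mspan S phi -> mspan S psi -> mspan S (fun g => phi g + psi g).
Proof.
have [_ _ SD _] := S_semiring => -[c Sc cE] [d Sd dE].
exists (fun e => c e + d e) => [e|g]; first exact: SD.
by rewrite cE dE -big_split; apply: eq_bigr => e _; rewrite mulrDl.
Qed.

Lemma mspanZ a phi : S a -> mspan S phi -> mspan S (fun g => a * phi g).
Proof.
have [_ _ _ SM] := S_semiring => Sa [c Sc cE].
exists (fun e => a * c e) => [e|g]; first exact: SM.
by rewrite cE mulr_sumr; apply: eq_bigr => e _; rewrite mulrA.
Qed.

Lemma mspan_sum (I : Type) (s : seq I) (phi : I -> G -> L) :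
  (forall i, mspan S (phi i)) -> mspan S (fun g => \sum_(i <- s) phi i g).
Proof.
move=> Sphi; elim: s => [|i s IHs].
  by apply: mspan_ext mspan0 => g; rewrite big_nil.
by apply: mspan_ext (mspanD (Sphi i) IHs) => g; rewrite big_cons.
Qed.

(* A relation expresses its leading monomial through monomials of smaller
   weight, where [T] has weight 1 and [U] has weight 2. *)
Definition reduces (m : nat * nat) : Prop :=
  exists n, exists2 d : 'I_n -> L, forall l, S (d l) &
  exists2 e : 'I_n -> nat * nat,
    forall l, ((e l).1 + 2 * (e l).2 < m.1 + 2 * m.2)%N &
    forall g, T g ^+ m.1 * U g ^+ m.2
              = \sum_l d l * (T g ^+ (e l).1 * U g ^+ (e l).2).

Hypotheses (redT : reduces (P, 0%N)) (redU : reduces (0%N, Q)).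

(** Induction on the weight [i + 2 * j]: a relation applied to a monomial that is not yet reduced
    leaves only monomials of smaller weight. *)
Lemma mspan_monomial i j : mspan S (fun g => T g ^+ i * U g ^+ j).
Proof.
have [S0 S1 _ _] := S_semiring.
have [w] := ubnP (i + 2 * j)%N; elim: w => // w IHw in i j *.
rewrite ltnS => le_w.
have step m : reduces m -> (m.1 <= i)%N -> (m.2 <= j)%N ->
    mspan S (fun g => T g ^+ i * U g ^+ j).
  move=> [n [d Sd [e lt_e eE]]] le_i le_j.
  have Se l : mspan S (fun g => T g ^+ ((e l).1 + (i - m.1))
                                * U g ^+ ((e l).2 + (j - m.2))).
    by apply: IHw; have := lt_e l; lia.
  apply: mspan_ext (mspan_sum (index_enum 'I_n) (fun l => mspanZ (Sd l) (Se l))).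
  move=> g; rewrite -(subnKC le_i) -(subnKC le_j) !exprD mulrACA eE mulr_suml.
  by apply: eq_bigr => l _; rewrite !addKn !exprD -[RHS]mulrA; congr (_ * _);
    apply: mulrACA.
have [le_i|lt_i] := leqP P i; first exact: step redT le_i _.
have [le_j|lt_j] := leqP Q j; first exact: step redU _ le_j.
exists (fun e => (e == (Ordinal lt_i, Ordinal lt_j))%:R) => [e|g].
  by case: (_ == _).
rewrite (bigD1 (Ordinal lt_i, Ordinal lt_j)) //= eqxx mul1r big1 ?addr0 //.
by move=> e /negPf->; rewrite mul0r.
Qed.

Lemma mspanM phi psi :
  mspan S phi -> mspan S psi -> mspan S (fun g => phi g * psi g).
Proof.
have [_ _ _ SM] := S_semiring => -[c Sc cE] [d Sd dE].
have Scd (e : 'I_P * 'I_Q) :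
    mspan S (fun g => \sum_e' (c e * d e') * (T g ^+ (e.1 + e'.1)
                                              * U g ^+ (e.2 + e'.2))).
  by apply: mspan_sum => e'; apply/mspanZ/mspan_monomial/SM.
apply: mspan_ext (mspan_sum (index_enum _) Scd) => g.
rewrite cE dE big_distrlr; apply: eq_bigr => e _; apply: eq_bigr => e' _ /=.
by rewrite !exprD; ring.
Qed.

Lemma mspan_cst a : S a -> mspan S (fun=> a).
Proof.
move=> Sa; apply: mspan_ext (mspanZ Sa (mspan_monomial 0 0)) => g.
by rewrite !mulr1.
Qed.

Lemma mspanT : mspan S T.
Proof. by apply: mspan_ext (mspan_monomial 1 0) => g; rewrite mulr1. Qed.

Lemma mspanU : mspan S U.
Proof. by apply: mspan_ext (mspan_monomial 0 1) => g; rewrite mul1r. Qed.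

End Closure.

Hypotheses (T_inj : injective T) (cardG : #|G| = (P * Q)%N).
Hypotheses (redT : reduces setT (P, 0%N)) (redU : reduces setT (0%N, Q)).

(** Lagrange interpolation in [T] alone: the product of the factors [phi h] over [h != g0] is 1 at
    [g0] and 0 elsewhere, and [mspanM] reduces it again. *)
Lemma mspan_delta g0 : mspan setT (fun g => (g == g0)%:R).
Proof.
have SL := subsemiring_setT L.
pose phi h g := (T g0 - T h)^-1 * (T g - T h).
have Sphi h : mspan setT (phi h).
  apply: mspanZ => //; apply: mspanD => //; first exact: mspanT.
  exact: mspan_cst.
have Sprod (s : seq G) : mspan setT (fun g => \prod_(h <- s | h != g0) phi h g).
  elim: s => [|h s IHs].
    by apply: mspan_ext (mspan_cst SL redT redU (a := 1) I) => g; rewrite big_nil.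
  have [->|h_ne] := eqVneq h g0.
    by apply: mspan_ext IHs => g; rewrite big_cons eqxx.
  apply: mspan_ext (mspanM SL redT redU (Sphi h) IHs) => g.
  by rewrite big_cons h_ne.
apply: mspan_ext (Sprod (index_enum G)) => g.
have [->|ne_g] := eqVneq g g0.
  by apply: big1 => h ne_h; rewrite /phi mulVf // subr_eq0 (inj_eq T_inj) eq_sym.
by rewrite (bigD1 g) //= /phi subrr mulr0 mul0r.
Qed.

Lemma sum_enum_val (I : finType) (F : I -> L) :
  \sum_e F e = \sum_(l < #|{: I}|) F (enum_val l).
Proof. by rewrite (reindex _ (onW_bij _ (@enum_val_bij I))). Qed.

(** Expanding the indicator functions gives a left inverse [C] of the matrix [M] of monomial values,
    so [M] has rank at least [#|G| = P * Q], its number of rows. *)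
Lemma monomials_free (d : 'I_P * 'I_Q -> L) :
  (forall g, \sum_e d e * (T g ^+ e.1 * U g ^+ e.2) = 0) -> forall e, d e = 0.
Proof.
move=> d0 e.
pose M := \matrix_(i < #|{: 'I_P * 'I_Q}|, j < #|G|)
  (T (enum_val j) ^+ (enum_val i).1 * U (enum_val j) ^+ (enum_val i).2).
have [C CM] : exists C, C *m M = 1%:M.
  have /choice[c cP] g : exists c : 'I_P * 'I_Q -> L, forall h,
      (h == g)%:R = \sum_e c e * (T h ^+ e.1 * U h ^+ e.2).
    by have [c _ cE] := mspan_delta g; exists c.
  exists (\matrix_(i < #|G|, j < #|{: 'I_P * 'I_Q}|) c (enum_val i) (enum_val j)).
  apply/matrixP => i j; rewrite !mxE eq_sym -(inj_eq enum_val_inj) cP.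
  rewrite [RHS]sum_enum_val.
  by apply: eq_bigr => l _; rewrite !mxE.
have M_free : row_free M.
  have le_rk : (P * Q <= \rank M)%N 
    by rewrite -cardG; have := mxrankM_maxr C M; rewrite CM mxrank1.
  by rewrite /row_free eqn_leq rank_leq_row (leq_trans _ le_rk) //
    card_prod !card_ord.
have dM : (\row_(i < #|{: 'I_P * 'I_Q}|) d (enum_val i)) *m M = 0.
  apply/rowP => j; rewrite !mxE -[RHS](d0 (enum_val j)).
  rewrite [RHS]sum_enum_val.
  by apply: eq_bigr => l _; rewrite !mxE.
have /matrixP/(_ 0 (enum_rank e)) :
    (\row_(i < #|{: 'I_P * 'I_Q}|) d (enum_val i)) = 0.
  by apply: (row_free_inj M_free); rewrite dM mul0mx.
by rewrite !mxE enum_rankK.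
Qed.

(** The constant also expands as [a] times the trivial monomial; by independence over [L] the two
    expansions agree, so [a] is the coefficient [c e0]. *)
Lemma mspan_cst_mem (S : set L) a :
  (0 < P)%N -> (0 < Q)%N -> mspan S (fun=> a) -> S a.
Proof.
move=> P0 Q0 [c Sc cE]; pose e0 := (Ordinal P0, Ordinal Q0).
suff /eqP : c e0 - a * (e0 == e0)%:R = 0.
  by rewrite eqxx mulr1 subr_eq0 => /eqP <-.
apply: (@monomials_free (fun e => c e - a * (e == e0)%:R)) => g.
under eq_bigr do rewrite mulrBl.
rewrite sumrB -cE (bigD1 e0) //= big1 => [|e /negPf->].
  by rewrite !expr0 !mulr1 addr0 subrr.
by rewrite mulr0 mul0r.
Qed.

End ReducedSpan.

(** * The determinants *)

Section LastColumn.
Variable R : comPzRingType.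

(** Cofactors along the last column do not involve its entries, so a zero column stands in for
    it. *)
Definition last_cofactor m (A : 'M[R]_(m + 1, m)) (i : 'I_(m + 1)) : R :=
  cofactor (row_mx A 0) i (rshift m ord0).

Lemma det_last_col m (A : 'M[R]_(m + 1, m)) (c : 'cV_(m + 1)) :
  \det (row_mx A c) = \sum_i last_cofactor A i * c i ord0.
Proof.
rewrite (expand_det_col _ (rshift m ord0)); apply: eq_bigr => i _.
rewrite row_mxEr mulrC; congr (_ * _); rewrite /last_cofactor /cofactor.
congr (_ * \det _); apply/matrixP => i' j'; rewrite !mxE.
case: split_ordP => k def_k //; case/eqP: (neq_lift (rshift m ord0) j').
by rewrite def_k (ord1 k).
Qed.

(** Taking the last unit vector as last column isolates this cofactor and makes the matrix block
    triangular. *)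
Lemma last_cofactor_last m (A : 'M[R]_(m + 1, m)) :
  last_cofactor A (rshift m ord0) = \det (usubmx A).
Proof.
have := det_last_col A (delta_mx (rshift m ord0) ord0).
rewrite (bigD1 (rshift m ord0)) //= mxE !eqxx mulr1 big1 ?addr0 => [<-|i /negPf ni].
  rewrite -{1}[A]vsubmxK.
  have -> : delta_mx (rshift m ord0) ord0 = col_mx 0 1%:M :> 'cV[R]_(m + 1).
    apply/colP => i; rewrite -(splitK i); case: (split i) => k /=.
      by rewrite col_mxEu !mxE eq_lrshift.
    by rewrite col_mxEd !mxE (ord1 k) !eqxx.
  by rewrite -block_mxEh det_lblock det1 mulr1.
by rewrite mxE ni mulr0.
Qed.

(** The sum is a determinant whose last column is a combination of the others. This makes the
    determinants vanish on the translation vectors of [G]. *)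
Lemma last_cofactor_mul m (A : 'M[R]_(m + 1, m)) (v : 'cV_m) :
  \sum_i last_cofactor A i * (A *m v) i ord0 = 0.
Proof.
rewrite -det_last_col.
have -> : row_mx A (A *m v) = row_mx A 0 *m block_mx 1%:M v 0 1%:M.
  by rewrite mul_row_block mulmx1 !mul0mx !addr0.
rewrite det_mulmx det_last_col big1 ?mul0r // => i _.
by rewrite mxE mulr0.
Qed.

End LastColumn.

Lemma last_cofactor_map (R S : comPzRingType) (f : {rmorphism R -> S}) m
    (A : 'M[R]_(m + 1, m)) i :
  last_cofactor (map_mx f A) i = f (last_cofactor A i).
Proof. by rewrite /last_cofactor -[0](map_mx0 f) -map_row_mx cofactor_map_mx. Qed.

(** * Weights of the rows *)

Section Weights.
Variable p : nat.
Hypothesis p_gt2 : (2 < p)%N.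

(** The weight of [T^(p^m)] or [U^(p^m)], and also the exponent of [x] in the denominator of the
    last-column entry of row [i]. *)
Definition row_wt (i : nat) : nat := ((odd i).+1 * p ^ i./2)%N.

(** Consecutive weights are [p^m < 2 p^m < p^(m+1)], the second inequality because [p > 2]. *)
Lemma row_wt_lt : {homo row_wt : i j / (i < j)%N}.
Proof.
apply: homo_ltn => [i j k|i]; first exact: ltn_trans.
rewrite /row_wt -uphalfE uphalf_half /=.
have : (0 < p ^ i./2)%N by rewrite expn_gt0; lia.
by case: (odd i) => /= p_gt0; rewrite ?add1n ?add0n ?expnS; nia.
Qed.

Lemma row_wt_le : {homo row_wt : i j / (i <= j)%N}.
Proof. by move=> i j; rewrite leq_eqVlt => /predU1P[->//|/row_wt_lt/ltnW]. Qed.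

End Weights.

(** * Nonvanishing of the minor [gamma] *)

Section GammaNonzero.
Variables p r : nat.
Hypothesis p_prime : prime p.

Let v (i : nat) (j : 'I_r) : 'I_(r + r) := if odd i then rshift r j else lshift r j.

Let v_inj i i' j j' : v i j = v i' j' -> odd i = odd i' /\ j = j'.
Proof.
rewrite /v; case: (odd i) (odd i') => -[] /eqP;
  rewrite ?(eq_lrshift, eq_rlshift) //.
  by rewrite (inj_eq (@rshift_inj _ _)) => /eqP.
by rewrite (inj_eq (@lshift_inj _ _)) => /eqP.
Qed.

(** The exponent of the Leibniz term of [s] in the determinant. *)
Let mon (s : 'S_r) : 'X_{1..r + r} := (\sum_(i < r) U_(v i (s i)) *+ (p ^ i./2))%MM.

Let mon_v s (i j : 'I_r) : mon s (v i j) =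
  (if odd (s^-1 j)%g == odd i then p ^ (s^-1 j)%g./2 else 0)%N.
Proof.
rewrite /mon mnm_sumE (bigD1 (s^-1 j)%g) //= big1 => [|l ne_l].
  rewrite addn0 mulmnE mnmE permKV; have [eq_v|ne_v] := eqVneq.
    by have [-> _] := v_inj eq_v; rewrite eqxx mul1n.
  by rewrite mul0n; case: eqP => // eq_o; rewrite /v eq_o eqxx in ne_v.
rewrite mulmnE mnmE; have [eq_v|//] := eqVneq.
by have [_ eq_l] := v_inj eq_v; rewrite -eq_l permK eqxx in ne_l.
Qed.

(** Comparing the exponents of the variable [v j j] gives first the parity of [s^-1 j], then its
    half, hence [s^-1 j = j]. *)
Let mon_inj s : mon s = mon 1%g -> s = 1%g.
Proof.
move=> eq_m; apply/permP => j; rewrite perm1.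
have := congr1 (fun m : 'X_{1..r + r} => m (v j j)) eq_m.
have p_gt1 := prime_gt1 p_prime.
rewrite /= !mon_v invg1 perm1 eqxx; case: eqP => [eq_o /eqP|_ /esym/eqP].
  rewrite eqn_exp2l // => /eqP eq_h; apply: (can_inj (permK s^-1%g)).
  rewrite permK; apply: val_inj.
  by rewrite /= -[RHS]odd_double_half eq_o eq_h odd_double_half.
by rewrite expn_eq0 -leqn0 leqNgt prime_gt0.
Qed.

Lemma gamma_neq0 : gamma p (@rows_I r) != 0.
Proof.
pose M : 'M[coefRing p r]_r := \matrix_(i, j) 'X_(v i j) ^+ (p ^ i./2).
have -> : gamma p (@rows_I r) = tofrac (\det M).
  rewrite -det_map_mx; congr (\det _); apply/matrixP => i j.
  rewrite !mxE inordK; last by rewrite -addnn; have := ltn_ord i; lia.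
  by rewrite /v rmorphXn /=; case: (odd i).
rewrite tofrac_eq0; apply/eqP => detM0.
have : (\det M)@_(mon 1%g) = 0 by rewrite detM0 mcoeff0.
have term (s : 'S_r) : \prod_i M i (s i) = 'X_[mon s].
  rewrite /mon (big_morph (fun m => 'X_[m] : coefRing p r)
    (@mpolyXD _ _) (@mpolyX0 _ _)).
  by apply: eq_bigr => i _; rewrite mxE mpolyXn.
have -> : \det M = \sum_(s : 'S_r) (-1) ^+ s * 'X_[mon s].
  by apply: eq_bigr => s _; rewrite term.
rewrite raddf_sum (bigD1 1%g) //= big1 => [|s ne_s].
  by rewrite odd_perm1 expr0 mul1r mcoeffX eqxx addr0 => /eqP; rewrite oner_eq0.
rewrite mulr_sign; case: ifP => _; rewrite ?mcoeffN mcoeffX;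
  by case: eqP => [/mon_inj/eqP|_]; rewrite ?oppr0 // (negPf ne_s).
Qed.

End GammaNonzero.

Lemma expr_subn_mul (L : fieldType) (u a : L) m n :
  u != 0 -> (n <= m)%N -> u ^+ (m - n) * a = u ^+ m * (a / u ^+ n).
Proof.
move=> u_neq0 le_nm; rewrite -[in RHS](subnK le_nm) exprD mulrACA.
by rewrite mulfV ?mulr1 // expf_neq0.
Qed.

(** * Minimal denominators of the determinants *)

Section Denominators.
Variables p r : nat.
Hypotheses (p_prime : prime p) (p_gt2 : (2 < p)%N).

Let x : ratField p r := tofrac (varx p r).

Definition emb : coefField p r -> ratField p r := fun c => tofrac (c%:MP).

HB.instance Definition _ :=
  GRing.RMorphism.copy emb (@tofrac (polRing p r) \o @mpolyC 3 (coefField p r)).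

Lemma varx_neq0 : varx p r != 0.
Proof.
apply/eqP => /(congr1 (mcoeff U_(inord 0)%MM)) /eqP.
by rewrite mcoeffXU eqxx mcoeff0 oner_eq0.
Qed.

Lemma x_neq0 : x != 0.
Proof. by rewrite tofrac_eq0 varx_neq0. Qed.

Definition rho (i : nat) : polRing p r :=
  (if odd i then - delta p r else vary p r) ^+ (p ^ i./2).

Lemma GammaColE i : GammaCol p r i ord0 = tofrac (rho i) / x ^+ row_wt p i.
Proof.
rewrite mxE /rho /row_wt; case: (odd i) => /=.
  by rewrite rmorphXn rmorphN /= expr_div_n exprM.
by rewrite rmorphXn /= expr_div_n mul1n.
Qed.

Variable J : 'I_(r + 1) -> 'I_(r.*2.+2).
Let t := J (rshift r ord0).
Hypotheses (J_low : forall k : 'I_r, J (lshift 1 k) = k :> nat)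
           (J_top : (r <= t)%N).

Let J_lt k : (J (lshift 1 k) < t)%N.
Proof. by rewrite J_low (leq_trans _ J_top). Qed.

Let wt_lt k : (row_wt p (J (lshift 1 k)) < row_wt p t)%N.
Proof. exact: row_wt_lt. Qed.

Lemma row_le_top i : (J i <= t)%N.
Proof.
by rewrite -(splitK i); case: (split i) => k /=; rewrite ?(ord1 k) // ltnW.
Qed.

Definition cof i : coefField p r := last_cofactor (rowsub J (Gamma p r)) i.

Lemma cof_top : cof (rshift r ord0) = gamma p (@rows_I r).
Proof.
rewrite /cof last_cofactor_last; congr (\det _); apply/matrixP => i j.
rewrite !mxE J_low inordK //.
by rewrite (leq_trans (ltn_ord i)) // -addnn -!addnS leq_addr.
Qed.

Lemma fTildeE : fTilde p J = \sum_i emb (cof i) * GammaCol p r (J i) ord0.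
Proof.
rewrite /fTilde /GammaTilde.
have -> (B : 'M[ratField p r]_(_, r)) (c : 'cV_(r.*2.+2)) :
    rowsub J (row_mx B c) = row_mx (rowsub J B) (rowsub J c).
  by apply/matrixP => i j; rewrite !mxE; case: split => k; rewrite mxE.
rewrite det_last_col; apply: eq_bigr => i _; rewrite [rowsub J _ _ _]mxE.
by congr (_ * _); rewrite -map_mxsub; apply: (last_cofactor_map emb).
Qed.

(** The power of [x] is that of the top row, which has the largest weight; [fJE] shows that it is
    the least one that clears the denominator. *)
Definition fnum : polRing p r :=
  \sum_i cof i *: (varx p r ^+ (row_wt p t - row_wt p (J i)) * rho (J i)).

Lemma fnumE : tofrac fnum = x ^+ row_wt p t * fTilde p J.
Proof.
rewrite fTildeE rmorph_sum mulr_sumr; apply: eq_bigr => i _ /=.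
move: (cof i) => c; rewrite GammaColE -mul_mpolyC !rmorphM rmorphXn /=.
rewrite [RHS]mulrCA; congr (_ * _).
exact: expr_subn_mul x_neq0 (row_wt_le p_gt2 (row_le_top i)).
Qed.

(** The point (0, 1, 0): for [x = 0] only the term of the top row survives, and [vary] and [delta]
    are 1 there. *)
Let pt (i : 'I_3) : coefField p r := (i == inord 1)%:R.

Lemma fnum_eval_neq0 : fnum.@[pt] != 0.
Proof.
have x0 : (varx p r).@[pt] = 0 by rewrite /varx mevalXU /pt -val_eqE /= !inordK.
have y1 : (vary p r).@[pt] = 1 by rewrite /vary mevalXU /pt eqxx.
rewrite /fnum raddf_sum (bigD1 (rshift r ord0)) //= big1 => [|i].
  rewrite addr0 subnn expr0 mul1r mevalZ cof_top mulf_neq0 ?gamma_neq0 //.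
  rewrite rmorphXn expf_neq0 //=; case: (odd _); rewrite ?y1 ?oner_eq0 //.
  by rewrite /delta mevalN mevalB rmorphXn /= y1 expr1n mevalM x0 mul0r subr0
    oppr_eq0 oner_eq0.
rewrite -(splitK i); case: (split i) => k /=; last by rewrite (ord1 k) eqxx.
move=> _; rewrite mevalZ mevalM rmorphXn /= x0 expr0n subn_eq0 leqNgt wt_lt.
by rewrite mul0r mulr0.
Qed.

Lemma fJE : fJ p J = fnum.
Proof.
(* With a smaller exponent [x] would divide [fnum], which would then vanish at [pt]. *)
have fnum_min m g : clears (fTilde p J) m g -> (row_wt p t <= m)%N.
  move=> gm; rewrite leqNgt; apply/negP => lt_m; case/eqP: fnum_eval_neq0.
  have -> : fnum = varx p r ^+ (row_wt p t - m) * g.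
    apply/eqP; rewrite -tofrac_eq fnumE rmorphM rmorphXn /= gm mulrA -exprD.
    by rewrite subnK // ltnW.
  rewrite mevalM rmorphXn /= /varx mevalXU /pt -val_eqE /= !inordK //.
  by rewrite expr0n subn_eq0 leqNgt lt_m mul0r.
apply: xget_unique => [|f [n fn n_min]].
  by exists (row_wt p t) => //; apply: fnumE.
have eq_n : n = row_wt p t.
  by apply/anti_leq; rewrite (n_min _ _ fnumE) (fnum_min _ _ fn).
by apply/eqP; rewrite -tofrac_eq fnumE -eq_n; apply/eqP.
Qed.

End Denominators.

(** * The group action *)

Section TotalActionTheory.
(* The library states these for actions on finite types only. *)
Variables (aT : finGroupType) (rT : Type) (to : {action aT &-> rT}).

Lemma total_actM u a b : to u (a * b)%g = to (to u a) b.
Proof. by case: to => to' [to_inj toM] /=; apply: toM; rewrite inE. Qed.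

Lemma total_act1 u : to u 1%g = u.
Proof.
have to_inj : injective (to^~ 1%g) by case: to => to' [to_inj toM]; apply: to_inj.
by apply: to_inj; rewrite /= -total_actM mulg1.
Qed.

End TotalActionTheory.

Section Action.
Variables (p r : nat) (to : {action 'rV['F_p]_r &-> polRing p r}).
Hypotheses (p_prime : prime p) (p_gt2 : (2 < p)%N) (to_G : is_G_action to).

Let x : ratField p r := tofrac (varx p r).

Definition g_act g : polRing p r -> polRing p r := to^~ g.

Let act_linear g : linear (g_act g).
Proof. exact: (to_G.1 g).1. Qed.

Let act_monoid g : monoid_morphism (g_act g).
Proof. exact: (to_G.1 g).2. Qed.

Let actD g h f : g_act (g + h) f = g_act h (g_act g f).
Proof. exact: total_actM. Qed.

Let act0 f : g_act 0 f = f.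
Proof. exact: total_act1. Qed.

HB.instance Definition _ g :=
  GRing.isLinear.Build (coefField p r) (polRing p r) (polRing p r) *:%R (g_act g)
    (act_linear g).
HB.instance Definition _ g :=
  GRing.isMonoidMorphism.Build (polRing p r) (polRing p r) (g_act g) (act_monoid g).

Definition cst : 'F_p -> coefField p r := fun c => tofrac (c%:MP).

HB.instance Definition _ :=
  GRing.RMorphism.copy cst (@tofrac (coefRing p r) \o @mpolyC (r + r) 'F_p).

Definition shift1 (g : 'rV['F_p]_r) : coefField p r :=
  \sum_j cst (g 0 j) * coefX1 p j.
Definition shift2 (g : 'rV['F_p]_r) : coefField p r :=
  \sum_j cst (g 0 j) * coefX2 p j.

Let acts_by g a b :=
  [/\ g_act g (varx p r) = varx p r,
      g_act g (vary p r) = vary p r + a *: varx p r &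
      g_act g (varz p r)
        = varz p r + (2 * a) *: vary p r + (a ^+ 2 + b) *: varx p r].

(** The pairs (a, b) simply add up: the cross term of [(a + c) ^+ 2] comes from letting [h] act on
    the [vary] part of the image of [varz]. *)
Let acts_byD g h a b c d : acts_by g a b -> acts_by h c d ->
  acts_by (g + h) (a + c) (b + d).
Proof.
move=> [gx gy gz] [hx hy hz]; split; rewrite actD.
- by rewrite gx hx.
- by rewrite gy linearD linearZ /= hx hy scalerDl -addrA [c *: _ + _]addrC.
rewrite gz !linearD !linearZ /= hx hy hz.
rewrite -!mul_mpolyC !(mpolyCD, mpolyCM, rmorphXn) /=.
by ring.
Qed.

Let acts_by0 : acts_by 0 0 0.
Proof.
by split; rewrite act0 ?expr0n ?mulr0 ?addr0 ?scale0r ?addr0.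
Qed.

Let acts_byMn g a b n : acts_by g a b -> acts_by (g *+ n) (a *+ n) (b *+ n).
Proof.
move=> gP; elim: n => [|n IHn]; first exact: acts_by0.
by rewrite !mulrS; apply: acts_byD.
Qed.

Lemma act_gens g : acts_by g (shift1 g) (shift2 g).
Proof.
rewrite [g in acts_by g]row_sum_delta /shift1 /shift2.
elim/big_rec3: _ => [|j a b h _ IHh]; first exact: acts_by0.
(* A coordinate in ['F_p] is read as a natural number, so its multiple of a unit vector is an
   iterated sum. *)
apply: acts_byD => //; rewrite -[g 0 j]natr_Zp scaler_nat rmorph_nat !mulr_natl.
by apply: acts_byMn; case: (to_G.2 j).
Qed.

(** The [shift1] terms cancel, so [g] translates [U = - delta / x^2] by the constant [shift2 g]. *)
Lemma act_delta g :
  g_act g (delta p r) = delta p r - shift2 g *: varx p r ^+ 2.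
Proof.
have [gx gy gz] := act_gens g.
rewrite /delta rmorphB rmorphXn rmorphM /= gx gy gz.
rewrite -!mul_mpolyC !(mpolyCD, mpolyCM, rmorphXn) /=.
by ring.
Qed.


Lemma pchar_coef : p \in [pchar coefField p r].
Proof. exact: (rmorph_pchar cst (pchar_Fp p_prime)). Qed.

Let pchar_pol : p \in [pchar polRing p r].
Proof. exact: (rmorph_pchar (@mpolyC 3 (coefField p r)) pchar_coef). Qed.

Let pnat_pX (R : nzSemiRingType) n : p \in [pchar R] -> ([pchar R]).-nat (p ^ n)%N.
Proof. by move=> Rp; rewrite pnatX (eq_pnat _ (pcharf_eq Rp)) pnat_id. Qed.

Definition shift g i : coefField p r :=
  (if odd i then shift2 g else shift1 g) ^+ (p ^ i./2).

(** The map [a ^+ (p ^ n)] is additive and fixes the coordinates of [g], as they come from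
    ['F_p]. *)
Lemma Gamma_shift g (i : 'I_(r.*2.+2)) :
  (Gamma p r *m (map_mx cst g)^T) i ord0 = shift g i.
Proof.
have frob (F : 'I_r -> coefField p r) n :
    (\sum_j cst (g 0 j) * F j) ^+ (p ^ n) = \sum_j cst (g 0 j) * F j ^+ (p ^ n).
  have ExpD a b := @exprDn_pchar _ a b _ (pnat_pX n pchar_coef).
  have Exp0 : 0 ^+ (p ^ n) = 0 :> coefField p r.
    by rewrite expr0n expn_eq0 -leqn0 leqNgt prime_gt0.
  rewrite (big_morph (fun a => a ^+ (p ^ n)) ExpD Exp0).
  apply: eq_bigr => j _; rewrite exprMn -rmorphXn; congr (cst _ * _).
  elim: n {ExpD Exp0} => [|n IHn]; first by rewrite expr1.
  by rewrite expnSr exprM IHn -[in X in _ ^+ X](card_Fp p_prime) expf_card.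
rewrite mxE /shift /shift1 /shift2; case odd_i: (odd i); rewrite frob;
  by apply: eq_bigr => j _; rewrite !mxE odd_i mulrC.
Qed.

Lemma act_rho g i :
  g_act g (rho p r i) = rho p r i + shift g i *: varx p r ^+ row_wt p i.
Proof.
have [_ gy _] := act_gens g.
have gE : g_act g (if odd i then - delta p r else vary p r)
  = (if odd i then - delta p r else vary p r)
    + (if odd i then shift2 g else shift1 g) *: varx p r ^+ (odd i).+1.
  case: (odd i) => //; by rewrite rmorphN /= act_delta opprB addrC.
rewrite /rho rmorphXn /= gE exprDn_pchar; last exact: pnat_pX pchar_pol.
by rewrite exprZn -exprM.
Qed.

(** The coordinates of [g] are the coefficients of the independent variables [x_{1j}]. *)
Lemma shift1_inj : injective shift1.
Proof.
have shift1E g : shift1 g = tofrac (\sum_j g 0 j *: 'X_(lshift r j)).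
  rewrite rmorph_sum; apply: eq_bigr => j _ /=.
  by rewrite -mul_mpolyC rmorphM.
move=> g h; rewrite !shift1E => /eqP; rewrite tofrac_eq => /eqP eq_gh.
apply/rowP => j; have := congr1 (mcoeff U_(lshift r j)%MM) eq_gh.
have coefE (u : 'rV['F_p]_r) :
    (\sum_j u 0 j *: ('X_(lshift r j) : coefRing p r))@_U_(lshift r j)%MM = u 0 j.
  rewrite raddf_sum (bigD1 j) //= big1 => [|k /negPf ne_k].
    by rewrite mcoeffZ mcoeffXU eqxx mulr1 addr0.
  by rewrite mcoeffZ mcoeffXU (inj_eq (@lshift_inj _ _)) ne_k mulr0.
by rewrite !coefE.
Qed.

(** The morphism structure of [g_act] rests on [to_G]; this form hands it on where it cannot be
    inferred from [g_act] alone. *)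
Lemma g_act_morphism g :
  exists phi : {lrmorphism polRing p r -> polRing p r}, g_act g =1 phi.
Proof. by exists (g_act g). Qed.

Lemma act_fnum (J : 'I_(r + 1) -> 'I_(r.*2.+2)) g :
    (forall k : 'I_r, J (lshift 1 k) = k :> nat) -> (r <= J (rshift r ord0))%N ->
  g_act g (fnum p J) = fnum p J.
Proof.
move=> J_low J_top; have [gx _ _] := act_gens g.
(* The shifts form a combination of the columns of [Gamma], so the cofactors annihilate them. *)
have cof0 : \sum_i cof p J i * shift g (J i) = 0.
  rewrite -[RHS](last_cofactor_mul (rowsub J (Gamma p r)) (map_mx cst g)^T).
  by apply: eq_bigr => i _; rewrite -Gamma_shift mul_rowsub_mx !mxE.
rewrite /fnum rmorph_sum /=.
rewrite -[RHS]addr0.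
rewrite -[X in _ = _ + X](scale0r (varx p r ^+ row_wt p (J (rshift r ord0)))).
rewrite -[X in X *: _]cof0 scaler_suml -big_split; apply: eq_bigr => i _ /=.
rewrite linearZ rmorphM rmorphXn /= gx act_rho mulrDr scalerDr; congr (_ + _).
rewrite -scalerAr -exprD subnK ?scalerA //.
exact: row_wt_le (row_le_top J_low J_top i).
Qed.

End Action.

(** * Relations between the translates of [T] and [U] *)

Section Descent.
Variables (p r : nat) (to : {action 'rV['F_p]_r &-> polRing p r}).
Hypotheses (p_prime : prime p) (p_gt2 : (2 < p)%N) (to_G : is_G_action to).

Let x : ratField p r := tofrac (varx p r).
Let x_neq0 : x != 0. Proof. exact: x_neq0. Qed.

Definition transT g : ratField p r := tofrac (g_act to g (vary p r)) / x.
Definition transU g : ratField p r := - tofrac (g_act to g (delta p r)) / x ^+ 2.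

Definition row_exp (i : nat) : nat * nat :=
  if odd i then (0%N, (p ^ i./2)%N) else ((p ^ i./2)%N, 0%N).

Definition trans_row g i : ratField p r :=
  transT g ^+ (row_exp i).1 * transU g ^+ (row_exp i).2.

Lemma row_exp_wt i : ((row_exp i).1 + 2 * (row_exp i).2)%N = row_wt p i.
Proof. by rewrite /row_exp /row_wt; case: (odd i) => /=; lia. Qed.

Lemma trans_rowE g i :
  trans_row g i = tofrac (g_act to g (rho p r i)) / x ^+ row_wt p i.
Proof.
have [phi phiE] := g_act_morphism to_G g.
rewrite /trans_row /row_exp /row_wt /transT /transU !phiE /rho rmorphXn.
case: (odd i) => /=.
  by rewrite expr0 mul1r rmorphN rmorphXn rmorphN /= expr_div_n exprM.
by rewrite expr0 mulr1 rmorphXn /= expr_div_n mul1n.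
Qed.

Lemma transT_inj : injective transT.
Proof.
have YE g : transT g = transT 0 + emb (shift1 g) - emb (shift1 0).
  have act_y h : g_act to h (vary p r) = vary p r + shift1 h *: varx p r.
    by have [_ ->] := act_gens to_G h.
  rewrite /transT !act_y -!mul_mpolyC !rmorphD !rmorphM /= -/x.
  by rewrite !mulrDl !mulfK // addrAC addrK.
move=> g h; rewrite (YE g) (YE h) => /addIr/addrI/eqP.
by rewrite tofrac_eq mpolyC_eq => /eqP/shift1_inj.
Qed.

Section Relation.
Variable J : 'I_(r + 1) -> 'I_(r.*2.+2).
Let t := J (rshift r ord0).
Hypotheses (J_low : forall k : 'I_r, J (lshift 1 k) = k :> nat)
           (J_top : (r <= t)%N).

(** By invariance of [fnum], replacing [T] and [U] by their translates leaves the determinant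
    unchanged; neither side's coefficients depend on [g]. *)
Lemma trans_relation g :
  \sum_i emb (cof p J i) * trans_row g (J i) = fTilde p J.
Proof.
have x_gt0 n : x ^+ n != 0 by rewrite expf_neq0.
apply: (mulfI (x_gt0 (row_wt p t))).
rewrite -fnumE // -(act_fnum p_prime p_gt2 to_G g J_low J_top).
have [gx _ _] := act_gens to_G g.
have [phi phiE] := g_act_morphism to_G g.
rewrite phiE /fnum !rmorph_sum mulr_sumr /=.
apply: eq_bigr => i _; move: (cof p J i) => c.
rewrite linearZ rmorphM rmorphXn /= -!phiE gx.
rewrite -mul_mpolyC !rmorphM rmorphXn /= [LHS]mulrCA trans_rowE; congr (_ * _).
exact: esym (expr_subn_mul _ x_neq0 (row_wt_le p_gt2 (row_le_top J_low J_top i))).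
Qed.

(** The coefficient of the top row is the nonzero constant [gamma]; dividing by it solves the
    relation for the monomial of greatest weight. *)
Lemma trans_reduces (S : set (ratField p r)) :
    subsemiring S -> (forall c, S (emb c)) -> S (fTilde p J) ->
  reduces transT transU S (row_exp t).
Proof.
move=> S_semiring S_emb S_F; have [S0 S1 SD SM] := S_semiring.
set a := (gamma p (@rows_I r))^-1.
(* Index 0 carries the constant term [fTilde / gamma], and the index lifted from [k] carries row
   [k]. *)
exists r.+1, (fun l => if unlift ord0 l is Some k
                       then emb (- (a * cof p J (lshift 1 k)))
                       else emb a * fTilde p J).
  move=> l; case: unlift => [k|]; first exact: S_emb.
  exact: SM (S_emb _) S_F.
exists (fun l => if unlift ord0 l is Some k then row_exp k else (0%N, 0%N)).
  move=> l; rewrite row_exp_wt; case: unlift => [k|].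
    by rewrite row_exp_wt row_wt_lt // (leq_trans _ J_top).
  by rewrite /= /row_wt muln_gt0 expn_gt0 (prime_gt0 p_prime).
move=> g; rewrite big_ord_recl unlift_none !mulr1.
under eq_bigr => k _ do rewrite liftK -/(trans_row g k).
rewrite -/(trans_row g t) -(trans_relation g) big_split_ord big_ord1 /=.
rewrite (cof_top _ J_low) mulrDr addrAC mulr_sumr -big_split big1 => [|k _].
  rewrite add0r mulrA -rmorphM mulVf ?rmorph1 ?mul1r //.
  exact: gamma_neq0.
rewrite /= J_low; move: (cof p J _) => c.
by rewrite rmorphN rmorphM mulNr mulrA addrN.
Qed.

End Relation.

End Descent.

(** * The invariants *)

(** Applied to translates of [x], [y], [z], it recovers [z] as [x (T^2 + U)]. *)
Lemma complete_square (L : fieldType) (a b c : L) :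
  a != 0 -> a * (b / a * (b / a) + - (b ^+ 2 - a * c) / a ^+ 2) = c.
Proof. by move=> a_neq0; field. Qed.

Section Rows.
Variable r : nat.

Lemma rows_J1_low (k : 'I_r) : rows_J1 (lshift 1 k) = k :> nat.
Proof. by rewrite inordK //= -addnn; have := ltn_ord k; lia. Qed.

Lemma rows_J1_top : rows_J1 (rshift r ord0) = r :> nat.
Proof. by rewrite inordK /= addn0 // -addnn; lia. Qed.

Lemma rows_J2_low (k : 'I_r) : rows_J2 (lshift 1 k) = k :> nat.
Proof. by rewrite /rows_J2 /= ltn_ord inordK // -addnn; have := ltn_ord k; lia. Qed.

Lemma rows_J2_top : rows_J2 (rshift r ord0) = r.+1 :> nat.
Proof. by rewrite /rows_J2 /= addn0 ltnn inordK // -addnn; lia. Qed.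

End Rows.

Section Invariants.
Variables (p r : nat) (to : {action 'rV['F_p]_r &-> polRing p r}).
Hypotheses (p_prime : prime p) (p_gt2 : (2 < p)%N) (to_G : is_G_action to).

Let P := (p ^ uphalf r)%N.
Let Q := (p ^ r./2)%N.

Section Subring.
Variable S : set (ratField p r).
Hypotheses (S_semiring : subsemiring S) (S_emb : forall c, S (emb c)).
Hypotheses (S_F1 : S (fTilde p (@rows_J1 r))) (S_F2 : S (fTilde p (@rows_J2 r))).

(** The top rows [r] and [r.+1] have opposite parities, so one determinant reduces a power of [T]
    and the other a power of [U]; the parity of [r] decides which does which. *)
Lemma trans_reduces_PQ :
  reduces (transT to) (transU to) S (P, 0%N) /\
  reduces (transT to) (transU to) S (0%N, Q).
Proof.
have le1 : (r <= @rows_J1 r (rshift r ord0))%N by rewrite rows_J1_top.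
have le2 : (r <= @rows_J2 r (rshift r ord0))%N by rewrite rows_J2_top.
have := trans_reduces p_prime p_gt2 to_G (@rows_J1_low r) le1 S_semiring S_emb S_F1.
have := trans_reduces p_prime p_gt2 to_G (@rows_J2_low r) le2 S_semiring S_emb S_F2.
rewrite rows_J1_top rows_J2_top /row_exp -uphalfE oddS /P /Q uphalf_half.
by case: (odd r).
Qed.

Hypothesis S_x : S (tofrac (varx p r)).

(** The polynomials with such an expansion are closed under sums and products and contain the
    constants, [x], [y = x T] and [z = x (T^2 + U)]. *)
Lemma mspan_orbit f :
  mspan (transT to) (transU to) P Q S (fun g => tofrac (g_act to g f)).
Proof.
have [redT redU] := trans_reduces_PQ.
pose M h := mspan (transT to) (transU to) P Q S (fun g => tofrac (g_act to g h)).
have x_neq0 := x_neq0 p r.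
have M_D h h' : M h -> M h' -> M (h + h').
  move=> Mh Mh'; apply: mspan_ext (mspanD S_semiring Mh Mh') => g /=.
  by have [phi phiE] := g_act_morphism to_G g; rewrite !phiE !rmorphD.
have M_M h h' : M h -> M h' -> M (h * h').
  move=> Mh Mh'; apply: mspan_ext (mspanM S_semiring redT redU Mh Mh') => g /=.
  by have [phi phiE] := g_act_morphism to_G g; rewrite !phiE !rmorphM.
have M_C c : M c%:MP.
  apply: mspan_ext (mspan_cst S_semiring redT redU (S_emb c)) => g /=.
  have [phi phiE] := g_act_morphism to_G g.
  by rewrite phiE -[c%:MP]mulr1 mul_mpolyC linearZ rmorph1 /= -mul_mpolyC mulr1.
have M_x : M (varx p r).
  apply: mspan_ext (mspan_cst S_semiring redT redU S_x) => g /=.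
  by have [-> _ _] := act_gens to_G g.
have M_y : M (vary p r).
  apply: mspan_ext (mspanZ S_semiring S_x (mspanT S_semiring redT redU)) => g /=.
  by rewrite /transT mulrC divfK.
have M_z : M (varz p r).
  have M_T := mspanT S_semiring redT redU; have M_U := mspanU S_semiring redT redU.
  have M_TT := mspanM S_semiring redT redU M_T M_T.
  apply: mspan_ext (mspanZ S_semiring S_x (mspanD S_semiring M_TT M_U)) => g /=.
  have [gx _ _] := act_gens to_G g.
  have [phi phiE] := g_act_morphism to_G g.
  have : tofrac (g_act to g (delta p r)) = tofrac (g_act to g (vary p r)) ^+ 2
                   - tofrac (varx p r) * tofrac (g_act to g (varz p r)).
    rewrite -[in X in _ - X * _]gx !phiE /delta.
    rewrite rmorphB rmorphXn /= (rmorphM _ (varx p r)) /=.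
    rewrite rmorphB rmorphXn /=.
    by rewrite (rmorphM _ (phi (varx p r))).
  by rewrite /transT /transU => ->; apply: complete_square.
have M_0 : M 0 by have := M_C 0; rewrite mpolyC0.
have M_1 : M 1 by have := M_C 1; rewrite mpolyC1.
rewrite -/(M f); elim/mpolyind: f => [//|c m f _ _ Mf].
apply: (M_D _ _ _ Mf); rewrite -mul_mpolyC; apply: (M_M _ _ (M_C c)).
rewrite mpolyXE_id; elim/big_rec: _ => [//|i h _ Mh].
apply: (M_M _ _ _ Mh); elim: (m i) => [//|n IHn].
rewrite exprS; apply: (M_M _ _ _ IHn) => {n IHn}.
by have -> : i = inord i by [rewrite inord_val]; case: i => -[|[|[|]]].
Qed.

End Subring.

(** [P * Q] is the order of the group and the orbit function of [f] is constant, so [mspan_cst_mem]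
    applies. *)
Lemma invariant_mem (S : set (ratField p r)) f :
    subsemiring S -> (forall c, S (emb c)) -> S (tofrac (varx p r)) ->
    S (fTilde p (@rows_J1 r)) -> S (fTilde p (@rows_J2 r)) ->
  (forall g, to f g = f) -> S (tofrac f).
Proof.
move=> S_semiring S_emb S_x S_F1 S_F2 f_inv.
have pX_gt0 n : (0 < p ^ n)%N by rewrite expn_gt0 prime_gt0.
have cardG : #|{: 'rV['F_p]_r}| = (P * Q)%N.
  rewrite card_mx card_Fp // mul1n -expnD; congr (_ ^ _)%N.
  by rewrite uphalf_half -addnA addnn odd_double_half.
(* Linear independence is over the whole field, so these relations take coefficients in [setT]; only
   the expansion of [f] is confined to [S]. *)
have [redT redU] := @trans_reduces_PQ setT (subsemiring_setT _) (fun=> I) I I.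
apply: (mspan_cst_mem (transT_inj to_G) cardG redT redU (pX_gt0 _) (pX_gt0 _)).
apply: mspan_ext (mspan_orbit S_semiring S_emb S_F1 S_F2 S_x f) => g.
by congr tofrac; apply: f_inv.
Qed.

End Invariants.

(** * The second invariant for even [r] *)

Section SecondInvariant.
Variables p r : nat.
Hypotheses (p_prime : prime p) (p_gt2 : (2 < p)%N) (r_gt0 : (0 < r)%N).

Lemma f1E : f1 p r = fnum p (@rows_J1 r).
Proof. by apply: fJE; rewrite ?rows_J1_top //; apply: rows_J1_low. Qed.

Lemma fJ2E : fJ p (@rows_J2 r) = fnum p (@rows_J2 r).
Proof. by apply: fJE; rewrite ?rows_J2_top //; apply: rows_J2_low. Qed.

Lemma fnum_leading (J : 'I_(r + 1) -> 'I_(r.*2.+2)) e :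
    (forall k : 'I_r, J (lshift 1 k) = k :> nat) ->
    (forall k : 'I_r, (e <= row_wt p (J (rshift r ord0)) - row_wt p k)%N) ->
  exists a, fnum p J = gamma p (@rows_I r) *: rho p r (J (rshift r ord0))
                       + varx p r ^+ e * a.
Proof.
move=> J_low le_e.
exists (\sum_(k < r) cof p J (lshift 1 k) *:
   (varx p r ^+ (row_wt p (J (rshift r ord0)) - row_wt p k - e) * rho p r k)).
rewrite /fnum big_split_ord big_ord1 /= (cof_top _ J_low) subnn expr0 mul1r addrC.
congr (_ + _); rewrite mulr_sumr; apply: eq_bigr => k _.
by rewrite -scalerAr mulrA -exprD subnKC // J_low.
Qed.

Lemma two_neq0 : 2 != 0 :> coefField p r.
Proof.
rewrite -(dvdn_pcharf (pchar_coef r p_prime)).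
by apply/negP => /dvdn_leq-/(_ isT); rewrite leqNgt p_gt2.
Qed.

(** The [p^n]-th power of [- delta = x z - y^2] is taken termwise. Its square term will cancel
    against the square of the leading term of [f1]. *)
Lemma rho_odd_square n : rho p r n.*2.+1 =
  varx p r ^+ (p ^ n) * varz p r ^+ (p ^ n) - rho p r n.*2 ^+ 2.
Proof.
rewrite /rho /= odd_double /= uphalf_double doubleK /delta opprB.
have pX : [pchar polRing p r].-nat (p ^ n)%N.
  have Ap : p \in [pchar polRing p r].
    exact: (rmorph_pchar (@mpolyC 3 (coefField p r)) (pchar_coef r p_prime)).
  by rewrite pnatX (eq_pnat _ (pcharf_eq Ap)) pnat_id.
by rewrite exprDn_pchar // exprNn_pchar // exprMn -!exprM mulnC.
Qed.

Let e := (p ^ uphalf r - 2 * p ^ (uphalf r).-1)%N.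

Lemma f2_relation : ~~ odd r ->
  (2 : coefField p r) *: (varx p r ^+ e * f2 p r)
  = gamma p (@rows_I r) *: fnum p (@rows_J2 r) + f1 p r ^+ 2.
Proof.
move=> even_r; rewrite f1E; set c := gamma p (@rows_I r).
have [q qE] : exists q, c *: fnum p (@rows_J2 r) + fnum p (@rows_J1 r) ^+ 2
                        = varx p r ^+ e * q.
  have r2 : r = (r./2.*2) by rewrite -[LHS]odd_double_half (negPf even_r).
  have le_e (k : 'I_r) : (e <= row_wt p r - row_wt p k)%N.
    (* For [r = 2s] rows [r] and [r.-1] have weights [p^s] and [2 p^(s-1)], so [e] is the smallest
       gap below row [r]; [r > 0] gives [s >= 1], which makes the predecessor genuine. *)
    have eE : e = (row_wt p r - row_wt p r.-1)%N.
      case def_s: (r./2) r2 => [|n] r2; first by have := r_gt0; rewrite r2.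
      rewrite /e /row_wt r2 doubleS /= !odd_double /= !uphalf_double doubleK.
      by rewrite mul1n.
    rewrite eE leq_sub2l //; apply: row_wt_le => //.
    by rewrite -ltnS prednK.
  have le_e2 (k : 'I_r) : (e <= row_wt p r.+1 - row_wt p k)%N.
    by apply: leq_trans (le_e k) _; rewrite leq_sub2r // ltnW // row_wt_lt.
  have [a1] := fnum_leading (J := @rows_J1 r) (e := e) (@rows_J1_low r)
    ltac:(by rewrite rows_J1_top).
  have [a2] := fnum_leading (J := @rows_J2 r) (e := e) (@rows_J2_low r)
    ltac:(by rewrite rows_J2_top).
  rewrite rows_J1_top rows_J2_top -/c => -> ->.
  have le_ps : (e <= p ^ r./2)%N by rewrite /e uphalf_half (negPf even_r) leq_subr.
  have -> : rho p r r.+1 = rho p r (r./2.*2.+1) by rewrite -r2.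
  rewrite rho_odd_square -r2 -(subnKC le_ps) exprD.
  set u := varx p r ^+ e; set y := rho p r r.
  set v := varx p r ^+ _; set w := _ ^+ (e + _).
  (* The terms in [c ^+ 2 * y ^+ 2] cancel; the witness is what remains after division by [u]. *)
  exists (c *: (c *: (v * w)) + c *: a2 + 2 * (c *: y) * a1 + u * a1 ^+ 2).
  rewrite -!mul_mpolyC; by ring.
have two_xE : 2 * tofrac (varx p r) ^+ e = tofrac (2%:MP * varx p r ^+ e).
  by rewrite rmorphM rmorphXn /= -[tofrac 2%:MP]/(emb 2) rmorph_nat.
have two_x_neq0 : tofrac (2%:MP * varx p r ^+ e) != 0 :> ratField p r.
  by rewrite tofrac_eq0 mulf_neq0 ?mpolyC_eq0 ?two_neq0 ?expf_neq0 ?varx_neq0.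
(* The polynomial [2^-1 *: q] shows that the fraction is a polynomial, so [xget] does not return its
   default. *)
have f2_frac : tofrac (f2 p r) =
   tofrac (c *: fJ p (@rows_J2 r) + f1 p r ^+ 2) / (2 * tofrac (varx p r) ^+ e).
  rewrite /f2 (negPf even_r); apply: (@xgetPex _ 0 (fun f => tofrac f = _)).
  exists (2^-1 *: q); rewrite fJ2E f1E qE two_xE.
  apply: (canRL (mulfK two_x_neq0)); rewrite -rmorphM; congr tofrac.
  by rewrite -mul_mpolyC mulrACA -mpolyCM mulVf ?two_neq0 // mpolyC1 mul1r mulrC.
have /eqP : tofrac (f2 p r) * tofrac (2%:MP * varx p r ^+ e)
            = tofrac (c *: fJ p (@rows_J2 r) + f1 p r ^+ 2).
  by rewrite f2_frac two_xE divfK.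
rewrite -rmorphM tofrac_eq fJ2E f1E => /eqP <-.
by rewrite -mul_mpolyC mulrA mulrC.
Qed.

End SecondInvariant.

(** * The algebra [k[x, u, v]] and its localization *)

Section GeneratedAlgebra.
Variables (p r : nat) (u v : polRing p r).

Let x : ratField p r := tofrac (varx p r).
Let x_neq0 : x != 0. Proof. exact: x_neq0. Qed.

Lemma alg_genC c : alg_gen u v c%:MP.
Proof. by exists c%:MP => //; rewrite comp_mpolyC. Qed.

Lemma alg_gen_x : alg_gen u v (varx p r).
Proof. by exists (varx p r) => //; rewrite {1}/varx comp_mpolyXU inordK. Qed.

Lemma alg_gen_u : alg_gen u v u.
Proof. by exists (vary p r) => //; rewrite {1}/vary comp_mpolyXU inordK. Qed.

Lemma alg_gen_v : alg_gen u v v.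
Proof. by exists (varz p r) => //; rewrite {1}/varz comp_mpolyXU inordK. Qed.

Lemma alg_genD a b : alg_gen u v a -> alg_gen u v b -> alg_gen u v (a + b).
Proof. by move=> [f _ <-] [g _ <-]; exists (f + g) => //; rewrite comp_mpolyD. Qed.

Lemma alg_genB a b : alg_gen u v a -> alg_gen u v b -> alg_gen u v (a - b).
Proof. by move=> [f _ <-] [g _ <-]; exists (f - g) => //; rewrite comp_mpolyB. Qed.

Lemma alg_genZ c a : alg_gen u v a -> alg_gen u v (c *: a).
Proof. by move=> [f _ <-]; exists (c *: f) => //; rewrite comp_mpolyZ. Qed.

Lemma alg_genM a b : alg_gen u v a -> alg_gen u v b -> alg_gen u v (a * b).
Proof. by move=> [f _ <-] [g _ <-]; exists (f * g) => //; rewrite rmorphM. Qed.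

Lemma alg_genX a n : alg_gen u v a -> alg_gen u v (a ^+ n).
Proof. by move=> [f _ <-]; exists (f ^+ n) => //; rewrite rmorphXn. Qed.

Lemma localize_alg_gen a : alg_gen u v a -> localize_x (alg_gen u v) (tofrac a).
Proof. by exists a, 0%N => //; rewrite expr0 divr1. Qed.

Lemma localize_div_x a n :
  localize_x (alg_gen u v) a -> localize_x (alg_gen u v) (a / x ^+ n).
Proof.
by move=> [s [m Ss ->]]; exists s, (m + n)%N; rewrite // exprD invfM mulrA.
Qed.

Lemma localize_alg_gen_semiring : subsemiring (localize_x (alg_gen u v)).
Proof.
have x_gt0 n : x ^+ n != 0 by rewrite expf_neq0.
split.
- by have := localize_alg_gen (alg_genC 0); rewrite mpolyC0 rmorph0.
- by have := localize_alg_gen (alg_genC 1); rewrite mpolyC1 rmorph1.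
- move=> _ _ [s [m Ss ->]] [s' [n Ss' ->]].
  exists (s * varx p r ^+ n + s' * varx p r ^+ m), (m + n)%N.
    by apply: alg_genD; apply: alg_genM => //; apply/alg_genX/alg_gen_x.
  by rewrite (addf_div _ _ (x_gt0 m) (x_gt0 n)) tofracD !tofracM !tofracXn exprD.
move=> _ _ [s [m Ss ->]] [s' [n Ss' ->]]; exists (s * s'), (m + n)%N.
  exact: alg_genM.
by rewrite mulf_div tofracM exprD.
Qed.

End GeneratedAlgebra.

Theorem theorem6p2 (p r : nat) (p_prime : prime p) (p_gt2 : (2 < p)%N)
    (r_gt0 : (0 < r)%N) (to : {action 'rV['F_p]_r &-> polRing p r})
    (to_G : is_G_action to) :
  localize_x (invariants to) = localize_x (alg_gen (f1 p r) (f2 p r)).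
Proof.
have top1 : (r <= @rows_J1 r (rshift r ord0))%N by rewrite rows_J1_top.
have top2 : (r <= @rows_J2 r (rshift r ord0))%N by rewrite rows_J2_top.
have f1_def := f1E r p_prime p_gt2.
have f2_odd : odd r -> f2 p r = fnum p (@rows_J2 r).
  by move=> odd_r; rewrite /f2 odd_r; apply: fJ2E.
have f2_even := f2_relation p_prime p_gt2 r_gt0.
have gen_F2 : alg_gen (f1 p r) (f2 p r) (fnum p (@rows_J2 r)).
  have [odd_r|even_r] := boolP (odd r).
    by rewrite -f2_odd //; apply: alg_gen_v.
  (* For even [r] the relation defining [f2] is solved for the second determinant by dividing by
     [gamma]. *)
  rewrite -(scalerK (gamma_neq0 r p_prime) (fnum p (@rows_J2 r))).
  have /(canLR (addrK _)) <- := f2_even even_r.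
  apply/alg_genZ/alg_genB; last exact/alg_genX/alg_gen_u.
  by apply/alg_genZ/alg_genM; [apply/alg_genX/alg_gen_x | exact: alg_gen_v].
have f1_inv g : g_act to g (f1 p r) = f1 p r.
  by rewrite f1_def; apply: (act_fnum p_prime p_gt2 to_G _ (@rows_J1_low r)).
have f2_inv g : g_act to g (f2 p r) = f2 p r.
  have F2_inv := act_fnum p_prime p_gt2 to_G g (@rows_J2_low r) top2.
  have [odd_r|even_r] := boolP (odd r); first by rewrite (f2_odd odd_r).
  have [gx _ _] := act_gens to_G g; have [phi phiE] := g_act_morphism to_G g.
  have := f2_even even_r; move: (fnum _ _) F2_inv => F2 F2_inv f2E.
  have actZ c f : g_act to g (c *: f) = c *: g_act to g f by rewrite !phiE linearZ.
  have actM a b : g_act to g (a * b) = g_act to g a * g_act to g b.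
    by rewrite !phiE rmorphM.
  have actX a n : g_act to g (a ^+ n) = g_act to g a ^+ n by rewrite !phiE rmorphXn.
  have actD a b : g_act to g (a + b) = g_act to g a + g_act to g b.
    by rewrite !phiE rmorphD.
  (* In the image of the relation under [g] only [f2] could change, and the factor [2 x^e] can be
     cancelled. *)
  have := congr1 (g_act to g) f2E.
  rewrite actD !actZ (actM _ (f2 p r)) (actX (varx p r)) (actX (f1 p r)).
  rewrite gx F2_inv f1_inv -f2E => /(scalerI (two_neq0 r p_prime p_gt2))/mulfI.
  by apply; rewrite expf_neq0 ?varx_neq0.
(* The inclusion from right to left comes first: elements of [k[x, f1, f2]] are invariant because
   the generators are. *)
apply/seteqP; split=> a [s [n Ss ->]]; last first.
  exists s, n => //; case: Ss => f _ <- g.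
  have [gx _ _] := act_gens to_G g; have [phi phiE] := g_act_morphism to_G g.
  rewrite -[to _ g]/(g_act to g _) phiE comp_mpolyE rmorph_sum /=.
  apply: eq_bigr => m _; rewrite linearZ rmorph_prod /=; congr (_ *: _).
  apply: eq_bigr => i _; rewrite rmorphXn; congr (_ ^+ _) => /=; rewrite -phiE.
  by case: i => -[|[|[|]]] //= lt_i; rewrite (tnth_nth 0).
apply: localize_div_x.
(* Going back from [fnum] to the determinant only divides by a power of [x]. *)
have fTilde_mem (J : 'I_(r + 1) -> 'I_(r.*2.+2)) :
    (forall k : 'I_r, J (lshift 1 k) = k :> nat) -> (r <= J (rshift r ord0))%N ->
    alg_gen (f1 p r) (f2 p r) (fnum p J) ->
  localize_x (alg_gen (f1 p r) (f2 p r)) (fTilde p J).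
  move=> J_low J_top /localize_alg_gen/localize_div_x.
  move/(_ (row_wt p (J (rshift r ord0)))).
  by rewrite fnumE // mulrC mulKf // expf_neq0 // x_neq0.
apply: (invariant_mem p_prime p_gt2 to_G) => //.
- exact: localize_alg_gen_semiring.
- by move=> c; apply/localize_alg_gen/alg_genC.
- exact/localize_alg_gen/alg_gen_x.
- apply: (fTilde_mem _ (@rows_J1_low r) top1).
  by rewrite -f1_def; apply: alg_gen_u.
exact: (fTilde_mem _ (@rows_J2_low r) top2 gen_F2).
Qed.
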